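(* Let $G$ be an infinite group generated by a finite symmetric set $S$, and suppose that $G$ has Kazhdan's property (T). Then there exists a constant $\varepsilon>0$ such that for all $r\in\mathbb{N}$, $$\mathfrak{C}_{G,S}(r)\;\ge\; \mathrm{e}^{\varepsilon r},$$ where $\mathfrak{C}_{G,S}$ is the coset covering function of $(G,S)$.
   Context: $G$ is a discrete group and $S$ is a finite symmetric ($S=S^{-1}$) generating set of $G$. $|g|_S$ denotes the word length of $g\in G$ with respect to $S$, and $B_r(G,S)=\{g\in G: |g|_S\le r\}$ is the ball of radius $r$. A coset of infinite index (c.i.i.) of $G$ is a set $C=Hg$ with $g\in G$ and $H\le G$ a subgroup of infinite index. The coset covering function of $(G,S)$ is $$\mathfrak{C}_{G,S}(r)=\min\Big\{N:\ \exists \text{ c.i.i.s } C_1,\dots,C_N \text{ of } G \text{ with } B_r(G,S)\subseteq \bigcup_{i=1}^N C_i\Big\}.$$ The cosets may be cosets of different subgroups. *)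

(* Defs.v *)
From HB Require Import structures.
From mathcomp Require Import all_boot all_order all_algebra.
From mathcomp Require Import sesquilinear complex.
From mathcomp Require Import all_classical all_reals all_analysis.

Set Implicit Arguments.
Unset Strict Implicit.
Unset Printing Implicit Defensive.

Import Order.TTheory GRing.Theory Num.Theory.
Import numFieldNormedType.Exports.

Local Open Scope classical_set_scope.
Local Open Scope ring_scope.

(* The minimum of a set of naturals, with junk value 0 on the empty set. *)
Definition nat_min (A : set nat) : nat :=
  xget 0%N [set n | A n /\ forall m, A m -> (n <= m)%N].

Lemma nat_minP (A : set nat) : A !=set0 ->
  A (nat_min A) /\ forall m, A m -> (nat_min A <= m)%N.
Proof.
move=> [n An].
have exA : exists n, `[< A n >] by exists n; apply/asboolP.
apply: (@xgetPex _ 0%N [set n | A n /\ forall m, A m -> (n <= m)%N]).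
case: (ex_minnP exA) => m /asboolP Am mmin; exists m; split => // k Ak.
by apply: mmin; apply/asboolP.
Qed.

Section Groups.
Variable G : groupType.
Implicit Types (S H C : set G) (g : G) (w : seq G).

Definition subgroup H : Prop :=
  H 1%g /\ forall x y, H x -> H y -> H (x / y)%g.

Definition symmetric_set S : Prop := forall s, S s -> S (s^-1)%g.

Definition generates S : Prop :=
  forall H, subgroup H -> S `<=` H -> H = [set: G].

Definition word_in S w g : Prop :=
  (forall s, s \in w -> S s) /\ (\prod_(s <- w) s)%g = g.

(* Inverses of elements of S are not allowed as letters: this is the word
   length with respect to S only for symmetric S. *)
Definition word_length S g : nat :=
  nat_min [set n | exists2 w, size w = n & word_in S w g].

Definition word_ball S (r : nat) : set G := [set g | (word_length S g <= r)%N].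

Definition right_coset H g : set G := [set (h * g)%g | h in H].

Definition infinite_index H : Prop := infinite_set (range (right_coset H)).

Definition cii C : Prop :=
  exists H g, [/\ subgroup H, infinite_index H & C = right_coset H g].

Definition covered_by_ciis S (r N : nat) : Prop :=
  exists C : 'I_N -> set G,
    (forall i, cii (C i)) /\ word_ball S r `<=` \bigcup_i C i.

Definition coset_covering S (r : nat) : nat :=
  nat_min [set N | covered_by_ciis S r N].

Lemma word_lengthP S g : symmetric_set S -> generates S ->
  exists2 w, size w = word_length S g & word_in S w g.
Proof.
move=> symS genS; suff: [set n | exists2 w, size w = n & word_in S w g] !=set0.
  by move=> /nat_minP[].
pose H := [set x : G | exists w, word_in S w x].
suff HT : H = [set: G].
  have [w wP] : H g by rewrite HT.
  by exists (size w), w.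
have word_inv w x : word_in S w x -> exists w', word_in S w' (x^-1)%g.
  elim: w x => [|a w IH] x [wS <-].
    by exists [::]; split => //; rewrite big_nil invg1.
  have [|w' [w'S w'E]] := IH (\prod_(s <- w) s)%g.
    by split => // s sw; apply: wS; rewrite inE sw orbT.
  exists (w' ++ [:: a^-1%g]); split => [s|].
    rewrite mem_cat !inE => /orP[/w'S //|/eqP->].
    by apply/symS/wS; rewrite inE eqxx.
  by rewrite big_cat big_seq1 w'E big_cons invgM.
apply: genS.
  split=> [|x y].
    by exists [::]; split => //; rewrite big_nil.
  move=> [w [wS <-]] [v] /word_inv[v' [v'S v'E]].
  exists (w ++ v'); split => [s|]; last by rewrite big_cat v'E.
  by rewrite mem_cat => /orP[/wS|/v'S].
move=> s Ss; exists [:: s]; split => [t|]; last by rewrite big_seq1.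
by rewrite inE => /eqP->.
Qed.

Lemma finite_word_ball S r : finite_set S -> symmetric_set S -> generates S ->
  finite_set (word_ball S r).
Proof.
move=> finS symS genS.
pose W n := [set g | exists2 w, size w = n & word_in S w g].
have finW n : finite_set (W n).
  elim: n => [|n IH].
    apply: (sub_finite_set _ (finite_set1 1%g)) => g [w /size0nil ->] [_ <-].
    by rewrite big_nil.
  apply: (sub_finite_set _ (finite_image2 (fun x y : G => (x * y)%g) finS IH)).
  move=> g [[//|a w] [sw] [wS <-]]; exists a; first by apply: wS; rewrite inE eqxx.
  exists (\prod_(s <- w) s)%g; last by rewrite big_cons.
  by exists w => //; split => // s ws; apply: wS; rewrite inE ws orbT.
have : finite_set (\bigcup_(n in `I_r.+1) W n) by exact: bigcup_finite.
apply: sub_finite_set => g gr; have [w sw wP] := word_lengthP g symS genS.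
by exists (word_length S g) => //=; exists w.
Qed.

Lemma coset_coveringP S r : infinite_set [set: G] -> finite_set S ->
    symmetric_set S -> generates S ->
  covered_by_ciis S r (coset_covering S r) /\
  forall N, covered_by_ciis S r N -> (coset_covering S r <= N)%N.
Proof.
move=> infG finS symS genS; apply: nat_minP.
have coset1 g : right_coset [set 1%g] g = [set g].
  by rewrite /right_coset image_set1 mul1g.
have /finite_seqP[s sE] := finite_word_ball r finS symS genS.
exists (size s), (fun i => [set nth 1%g s i]); split => [i|].
  exists [set 1%g], (nth 1%g s i); split; last by rewrite coset1.
    by split=> [|x y] //= -> ->; rewrite divg1.
  move=> fin; apply: infG.
  apply: (sub_finite_set _ (bigcup_finite fin (F := id) _)) => [g _|A [g _ <-]].
    by exists (right_coset [set 1%g] g); [exists g|rewrite coset1].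
  by rewrite /= coset1; exact: finite_set1.
rewrite sE => g /= gs.
have gi : (index g s < size s)%N by rewrite index_mem.
by exists (Ordinal gi) => //=; rewrite nth_index.
Qed.

End Groups.

(* The inner product is linear in its first argument. *)
Structure hilbertType (R : realType) := HilbertType {
  hilbert_sort :> completeNormedModType R[i];
  inner : {dot hilbert_sort for Num.conj};
  inner_norm : forall v, inner v v = `|v| ^+ 2 }.

Definition unitary (R : realType) (V : hilbertType R)
    (T : {linear V -> V}) : Prop :=
  bijective T /\ forall u v : V, inner V (T u) (T v) = inner V u v.

(* G is discrete, so that continuity of pi is automatic. *)
Definition unitary_representation (R : realType) (G : groupType)
    (V : hilbertType R) (pi : G -> {linear V -> V}) : Prop :=
  (forall g, unitary (pi g)) /\
  (forall (g h : G) (v : V), pi (g * h)%g v = pi g (pi h v)).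

(* The compact subsets of the discrete group G are its finite subsets. *)
Definition property_T (R : realType) (G : groupType) : Prop :=
  exists (Q : set G) (eps : R), [/\ finite_set Q, 0 < eps &
    forall (V : hilbertType R) (pi : G -> {linear V -> V}),
      unitary_representation pi ->
      (exists v : V, v != 0 /\
         forall q, Q q -> `|pi q v - v| < (eps%:C)%C * `|v|) ->
      exists v : V, v != 0 /\ forall g, pi g v = v].

(* Main.v *)
Require Import Defs.
From HB Require Import structures.
From mathcomp Require Import all_boot all_order all_algebra.
From mathcomp Require Import sesquilinear complex.
From mathcomp Require Import all_classical all_reals all_analysis.
From mathcomp Require Import ring lra.

Set Implicit Arguments.
Unset Strict Implicit.
Unset Printing Implicit Defensive.

Import Order.TTheory GRing.Theory Num.Theory.
Import numFieldNormedType.Exports.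

Local Open Scope classical_set_scope.
Local Open Scope ring_scope.

(** Let H be a subgroup of infinite index. The quasi-regular representation of
G on l2(H\G) has no nonzero invariant vector, as such a vector would be a
nonzero constant function on an infinite set. Property (T) therefore supplies
a constant k > 0, depending on (G, S) but not on H, such that every vector v of
every such representation is moved by at least k |v| by some s in S
([kazhdan_gap]).

Consider the random walk on G that starts at 1 and multiplies on the right by an
element of S, or stays put, with fixed positive probabilities. Its Markov
operator M averages v with its S-translates. By the parallelogram identity, the
sum of v and of a translate of v at distance at least k |v| has norm at most
(2 - k^2/4) |v|, so M contracts every vector by a factor c < 1 that depends only
on k and S ([markov_contract]). The probability that the walk is in the coset Hg
after r steps is the value at the coset H of the r-th iterate of M on the unit
vector supported on Hg; it is thus at most c^r ([walk_avg_coset]).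

After r steps the walk is in the ball of radius r. If N cosets of infinite index
cover that ball, then 1 <= N c^r, which is the claim with epsilon = - ln c.

Most of the work is to produce l2(H\G) as a complex Hilbert space. The group G is
countable and H has infinite index, so H\G can be enumerated by the natural
numbers; it suffices to construct l2(nat) and to let permutations of nat act on
it by unitary operators. *)

(** * Real series with nonnegative terms *)

Lemma nonneg_series_bounded (R : realType) (a : R^nat) (M : R) :
  (forall n, 0 <= a n) -> (forall n, \sum_(k < n) a k <= M) ->
  cvgn (series a) /\ limn (series a) <= M.
Proof.
move=> a0 aM; have aM' n : series a n <= M by rewrite /series /= big_mkord aM.
have ca : cvgn (series a).
  apply: nondecreasing_is_cvgn; first exact: nondecreasing_series.
  by exists M => _ [n _ <-].
by split=> //; apply: limr_le => //; exact: nearW.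
Qed.

Lemma partial_sum_le_lim (R : realType) (a : R^nat) n :
  (forall n, 0 <= a n) -> cvgn (series a) -> \sum_(k < n) a k <= limn (series a).
Proof.
move=> a0 ca.
have := nondecreasing_cvgn_le (nondecreasing_series (fun n _ _ => a0 n)) ca n.
by rewrite /series /= big_mkord.
Qed.

(** An injective reindexing sends any initial segment into an initial segment,
so it cannot enlarge the sum; this is what makes permutations act on l2. *)
Lemma series_comp_inj (R : realType) (a : R^nat) (s : nat -> nat) :
    (forall n, 0 <= a n) -> cvgn (series a) -> injective s ->
  cvgn (series (a \o s)) /\ limn (series (a \o s)) <= limn (series a).
Proof.
move=> a0 ca sI; apply: nonneg_series_bounded => [n|n] /=; first exact: a0.
pose m := (\max_(k < n) (s k)).+1.
apply: (@le_trans _ _ (\sum_(k < m) a k)); last exact: partial_sum_le_lim.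
rewrite -(big_mkord xpredT (fun k => a (s k))) -(big_map s xpredT a).
rewrite -(big_mkord xpredT a).
set r := map _ _.
have -> : \sum_(i <- r) a i = \sum_(i <- index_iota 0 m | i \in r) a i.
  rewrite -[RHS]big_filter; apply: perm_big; apply: uniq_perm.
  - by rewrite map_inj_uniq ?iota_uniq.
  - by rewrite filter_uniq ?iota_uniq.
  move=> i; rewrite mem_filter; case: (boolP (i \in r)) => //= ir.
  move: ir => /mapP[k]; rewrite !mem_index_iota => /andP[_ kn] ->.
  by rewrite /= ltnS (leq_bigmax (Ordinal kn)).
rewrite [leLHS]big_mkcond /=; apply: ler_sum => i _; case: ifP => // _; exact: a0.
Qed.

(** * The space of square-summable complex sequences *)

Section ComplexSeries.
Variable R : realType.
Implicit Types (z w : nat -> R[i]).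

Definition csummable z :=
  cvgn (series (fun n => complex.Re (z n))) /\
  cvgn (series (fun n => complex.Im (z n))).

(** Summing real and imaginary parts separately keeps all limits in the reals. *)
Definition csum z : R[i] :=
  Complex (limn (series (fun n => complex.Re (z n))))
          (limn (series (fun n => complex.Im (z n)))).

Lemma csumD z w : csummable z -> csummable w ->
  csum (fun n => z n + w n) = csum z + csum w.
Proof.
move=> [zr zi] [wr wi]; rewrite /csum /GRing.add /=.
have ReD x y : complex.Re (x + y : R[i]) = complex.Re x + complex.Re y.
  by case: x y => ? ? [].
have ImD x y : complex.Im (x + y : R[i]) = complex.Im x + complex.Im y.
  by case: x y => ? ? [].
by congr Complex; rewrite -lim_seriesD//; congr (limn (series _));
  apply/funext => n; [exact: ReD|exact: ImD].
Qed.

Lemma csumZ a z : csummable z -> csum (fun n => a * z n) = a * csum z.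
Proof.
case: a => a b [zr zi]; rewrite /csum /GRing.mul /=.
have E (x y : R) : (fun n => x * complex.Re (z n) + y * complex.Im (z n)) =
    x *: (fun n => complex.Re (z n)) + y *: (fun n => complex.Im (z n)) by [].
have lE (x y : R) :
    limn (series (fun n => x * complex.Re (z n) + y * complex.Im (z n))) =
    x * limn (series (fun n => complex.Re (z n))) +
    y * limn (series (fun n => complex.Im (z n))).
  have cr := is_cvg_seriesZ (k := x) zr; have ci := is_cvg_seriesZ (k := y) zi.
  by rewrite E (lim_seriesD cr ci) (lim_seriesZ _ zr) (lim_seriesZ _ zi).
congr Complex.
  rewrite -mulNr -lE; congr (limn (series _)); apply/funext => n.
  by case: (z n) => c d /=; rewrite mulNr.
by rewrite addrC -lE; congr (limn (series _)); apply/funext => n;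
  case: (z n) => c d /=; rewrite addrC.
Qed.

Lemma csum_conj z : csummable z -> csum (fun n => (z n)^*%C) = (csum z)^*%C.
Proof.
move=> [zr zi]; rewrite /csum /=; congr Complex.
  by congr (limn (series _)); apply/funext => n; case: (z n).
by rewrite -lim_seriesN //; congr (limn (series _)); apply/funext => n;
  rewrite [RHS]/GRing.opp /=; case: (z n).
Qed.

Definition sqmod (z : R[i]) : R := complex.Re z ^+ 2 + complex.Im z ^+ 2.

Lemma sqmod_ge0 (z : R[i]) : 0 <= sqmod z.
Proof. by rewrite addr_ge0 ?sqr_ge0. Qed.

Lemma sqmodE (z : R[i]) : (sqmod z)%:C%C = `|z| ^+ 2.
Proof. exact: add_Re2_Im2. Qed.

Lemma sqmodM (z w : R[i]) : sqmod (z * w) = sqmod z * sqmod w.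
Proof. by case: z w => [a b] [c d]; rewrite /sqmod /=; ring. Qed.

Lemma sqmodD_le (z w : R[i]) : sqmod (z + w) <= 2 * sqmod z + 2 * sqmod w.
Proof.
case: z w => [a b] [c d]; rewrite /sqmod /= -subr_ge0.
rewrite [leRHS](_ : _ = (a - c) ^+ 2 + (b - d) ^+ 2); last by ring.
by rewrite addr_ge0 ?sqr_ge0.
Qed.

Definition square_summable : {pred nat -> R[i]} :=
  fun f => `[< cvgn (series (fun n => sqmod (f n))) >].

Lemma square_summableP (f : nat -> R[i]) :
  reflect (cvgn (series (fun n => sqmod (f n)))) (f \in square_summable).
Proof. exact: asboolP. Qed.

Lemma square_summable_submod : subsemimod_closed square_summable.
Proof.
split; [split|].
- apply/(square_summableP 0).
  rewrite (_ : (fun n => _) = fun=> 0); last first.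
    by apply/funext => n; rewrite /sqmod /= expr0n addr0.
  have [||//] := @nonneg_series_bounded R (fun=> 0) 0; first by [].
  by move=> n; rewrite big1.
- move=> f g /(square_summableP f) cf /(square_summableP g) cg.
  apply/(square_summableP (f + g)).
  apply: (@series_le_cvg _ _
    (2 *: (fun n => sqmod (f n)) + 2 *: (fun n => sqmod (g n)))).
  + by move=> n; exact: sqmod_ge0.
  + by move=> n; apply: addr_ge0; apply: mulr_ge0; rewrite ?sqmod_ge0.
  + by move=> n; exact: sqmodD_le.
  + by apply: is_cvg_seriesD; exact: is_cvg_seriesZ.
- move=> a f /(square_summableP f) cf; apply/(square_summableP (a *: f)).
  rewrite (_ : (fun n => _) = sqmod a *: (fun n => sqmod (f n))).
    exact: is_cvg_seriesZ.
  by apply/funext => n; exact: sqmodM.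
Qed.

HB.instance Definition _ :=
  GRing.isSubSemiModClosed.Build R[i] (nat -> R[i]) square_summable
    square_summable_submod.

Record l2 := L2 { l2_val :> nat -> R[i]; l2P : l2_val \in square_summable }.

HB.instance Definition _ := [isSub for l2_val].
HB.instance Definition _ := gen_eqMixin l2.
HB.instance Definition _ := gen_choiceMixin l2.
HB.instance Definition _ := [SubChoice_isSubLmodule of l2 by <:].


Lemma abs_series_cvg (a b : nat -> R) : (forall n, `|a n| <= b n) ->
  cvgn (series b) -> cvgn (series a).
Proof.
move=> ab cb; apply: normed_cvg; apply: (@series_le_cvg _ _ b) => // n.
  exact: normr_ge0.
exact: (le_trans (normr_ge0 (a n)) (ab n)).
Qed.

Lemma csummable_mulJ (u v : l2) : csummable (fun n => u n * (v n)^*%C).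
Proof.
have /(square_summableP u) cu := l2P u; have /(square_summableP v) cv := l2P v.
have c := is_cvg_seriesD cu cv.
have le_mulJ (x y : R[i]) : `|complex.Re (x * y^*%C)| <= sqmod x + sqmod y /\
                            `|complex.Im (x * y^*%C)| <= sqmod x + sqmod y.
  case: x y => [a b] [a' b']; rewrite /sqmod /= !ler_norml.
  (* all four bounds are linear in these squares *)
  have := (sqr_ge0 (a + a'), sqr_ge0 (a - a'),
           sqr_ge0 (b + b'), sqr_ge0 (b - b')).
  have := (sqr_ge0 (a + b'), sqr_ge0 (a - b'),
           sqr_ge0 (b + a'), sqr_ge0 (b - a')).
  have := (sqr_ge0 a, sqr_ge0 b, sqr_ge0 a', sqr_ge0 b').
  move=> [[[? ?] ?] ?] [[[? ?] ?] ?] [[[? ?] ?] ?].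
  by split; apply/andP; split; lra.
by split; apply: abs_series_cvg c => n; have [] := le_mulJ (u n) (v n).
Qed.

Definition l2_dot (u v : l2) : R[i] := csum (fun n => u n * (v n)^*%C).

Lemma l2_dotP a (u v w : l2) :
  l2_dot (a *: u + v) w = a * l2_dot u w + l2_dot v w.
Proof.
rewrite /l2_dot -csumZ; last exact: csummable_mulJ.
rewrite -csumD; last exact: csummable_mulJ.
  by congr csum; apply/funext => n; rewrite mulrA -mulrDl.
have := csummable_mulJ (a *: u) w; congr (csummable _); apply/funext => n.
by rewrite mulrA.
Qed.

Lemma l2_dotC u v : l2_dot u v = (l2_dot v u)^*%C.
Proof.
rewrite /l2_dot -csum_conj; last exact: csummable_mulJ.
by congr csum; apply/funext => n; rewrite rmorphM /= conjcK mulrC.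
Qed.

Definition l2_sq (u : l2) : R := limn (series (fun n => sqmod (u n))).

Lemma l2_dotE u : l2_dot u u = (l2_sq u)%:C%C.
Proof.
rewrite /l2_dot /csum; congr Complex.
  congr (limn (series _)); apply/funext => n; rewrite /sqmod.
  by case: (u n) => a b /=; ring.
rewrite (_ : (fun n => _) = fun=> 0); last first.
  by apply/funext => n; case: (u n) => a b /=; ring.
rewrite (_ : series _ = fun=> 0) ?lim_cst//.
by apply/funext => n; rewrite /series /= big1.
Qed.

Lemma l2_sq_coord (u : l2) n : sqmod (u n) <= l2_sq u.
Proof.
have /(square_summableP u) cu := l2P u.
have := @partial_sum_le_lim R _ n.+1 (fun n => sqmod_ge0 (u n)) cu.
apply: le_trans; rewrite big_ord_recr /= lerDr; apply: sumr_ge0 => i _.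
exact: sqmod_ge0.
Qed.

Lemma sqmod_eq0 (x : R[i]) : sqmod x <= 0 -> x = 0.
Proof.
move=> x0; apply/eqP; rewrite -normr_eq0 -sqrf_eq0 -sqmodE.
by rewrite (_ : sqmod x = 0)//; apply/eqP; rewrite eq_le x0 sqmod_ge0.
Qed.

Lemma l2_dot_gt0 (u : l2) : u != 0 -> 0 < l2_dot u u.
Proof.
move=> u0; rewrite l2_dotE ltcR; apply: contra_neqT u0; rewrite -leNgt => s0.
apply/val_inj/funext => n; apply: sqmod_eq0; exact: le_trans (l2_sq_coord u n) s0.
Qed.

Lemma l2_dot_bilinear :
  bilinear_for ( *%R : GRing.Scale.law R[i] R[i])
    (Num.conj \; *%R : GRing.Scale.law R[i] R[i]) l2_dot.
Proof.
split=> [w a u v|w a u v]; first exact: l2_dotP.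
by rewrite [LHS]l2_dotC l2_dotP rmorphD rmorphM /= (l2_dotC w u) (l2_dotC w v).
Qed.

HB.instance Definition _ :=
  bilinear_isBilinear.Build R[i] l2 l2 R[i] *%R (Num.conj \; *%R) l2_dot
    l2_dot_bilinear.

Lemma l2_dot_hermitian u v : l2_dot u v = (-1) ^+ false * Num.conj (l2_dot v u).
Proof. by rewrite expr0 mul1r; exact: l2_dotC. Qed.

HB.instance Definition _ :=
  isHermitianSesquilinear.Build R[i] l2 false Num.conj l2_dot l2_dot_hermitian.
HB.instance Definition _ := isDotProduct.Build R[i] l2 l2_dot l2_dot_gt0.

End ComplexSeries.

(** * The Hilbert space structure on square-summable sequences *)

Section L2Norm.
Variable R : realType.
Implicit Types u v w : l2 R.

Definition l2_nrm u : R := Num.sqrt (l2_sq u).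

Lemma l2_sq_ge0 u : 0 <= l2_sq u.
Proof. exact: le_trans (sqmod_ge0 (u 0%N)) (l2_sq_coord u 0). Qed.

Lemma l2_nrm_sqr u : l2_nrm u ^+ 2 = l2_sq u.
Proof. by rewrite sqr_sqrtr ?l2_sq_ge0. Qed.

Lemma l2_sqZ a u : l2_sq (a *: u) = sqmod a * l2_sq u.
Proof.
apply: complexI; rewrite -l2_dotE linearZl_LR linearZr_LR /= l2_dotE mulrA.
by rewrite rmorphM /= sqmodE sqr_normc.
Qed.

Lemma l2_sqD u v :
  l2_sq (u + v) = l2_sq u + l2_sq v + 2 * complex.Re (l2_dot u v).
Proof.
apply: complexI; rewrite -l2_dotE dnormD /= !l2_dotE.
rewrite [X in _ + X](_ : _ = (2 * complex.Re (l2_dot u v))%:C%C) ?rmorphD//.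
by rewrite rmorphM rmorph_nat; exact: addcJ.
Qed.

Lemma l2_sq_eq0 u : l2_sq u = 0 -> u = 0.
Proof.
move=> u0; apply/eqP; case: eqVneq => // /l2_dot_gt0.
by rewrite l2_dotE u0 ltxx.
Qed.

(** The real half of the Cauchy-Schwarz inequality, which is all that the
triangle inequality uses: with a = |u| and b = |v|, expand
0 <= |b u - a v|^2 = 2 a b (a b - Re <u, v>). *)
Lemma Re_l2_dot_le u v : complex.Re (l2_dot u v) <= l2_nrm u * l2_nrm v.
Proof.
have [u0|u0] := eqVneq (l2_nrm u) 0.
  have -> : u = 0 by apply: l2_sq_eq0; rewrite -l2_nrm_sqr u0 expr0n.
  by rewrite linear0l mulr_ge0 ?sqrtr_ge0.
have [v0|v0] := eqVneq (l2_nrm v) 0.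
  have -> : v = 0 by apply: l2_sq_eq0; rewrite -l2_nrm_sqr v0 expr0n.
  by rewrite linear0r mulr_ge0 ?sqrtr_ge0.
have ab : 0 < l2_nrm u * l2_nrm v by rewrite mulr_gt0 // lt_def ?u0 ?v0 sqrtr_ge0.
have := l2_sq_ge0 ((l2_nrm v)%:C%C *: u + (- (l2_nrm u))%:C%C *: v).
have ReZ (x y : R) : complex.Re (l2_dot (x%:C%C *: u) (y%:C%C *: v)) =
    x * y * complex.Re (l2_dot u v).
  by rewrite linearZl_LR linearZr_LR /=; ring.
rewrite l2_sqD !l2_sqZ ReZ /sqmod /= !expr0n /= !addr0 sqrrN -!l2_nrm_sqr.
by move=> h; rewrite -(ler_pM2l ab); nra.
Qed.

Definition l2_norm u : R[i] := (l2_nrm u)%:C%C.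

Lemma l2_nrmD u v : l2_nrm (u + v) <= l2_nrm u + l2_nrm v.
Proof.
rewrite -ler_sqr ?nnegrE ?addr_ge0 ?sqrtr_ge0// l2_nrm_sqr l2_sqD.
have := Re_l2_dot_le u v; rewrite sqrrD !l2_nrm_sqr; lra.
Qed.

Lemma l2_normD u v : l2_norm (u + v) <= l2_norm u + l2_norm v.
Proof. by rewrite /l2_norm -rmorphD lecR l2_nrmD. Qed.

Lemma l2_normZ a u : l2_norm (a *: u) = `|a| * l2_norm u.
Proof.
rewrite /l2_norm /l2_nrm l2_sqZ sqrtrM ?sqmod_ge0// rmorphM /=; congr (_ * _).
by rewrite normc_def.
Qed.

Lemma l2_norm0_eq0 u : l2_norm u = 0 -> u = 0.
Proof.
move=> u0; apply: l2_sq_eq0; rewrite -l2_nrm_sqr.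
by have /complexI -> : l2_norm u = 0%:C%C; rewrite ?expr0n.
Qed.

HB.instance Definition _ :=
  @Lmodule_isNormed.Build R[i] (l2 R) l2_norm l2_normD l2_normZ l2_norm0_eq0.

Lemma l2_normE u : `|u| = (l2_nrm u)%:C%C.
Proof. by []. Qed.

Lemma l2_coord_nrm u n : sqmod (u n) <= l2_nrm u ^+ 2.
Proof. by rewrite l2_nrm_sqr; exact: l2_sq_coord. Qed.

Lemma l2_ballE u v (e : R) : ball u e%:C%C v = (l2_nrm (u - v) < e) :> Prop.
Proof. by rewrite -ball_normE /= l2_normE ltcR. Qed.

(** The coordinates of a Cauchy filter converge, to a sequence w say. If F is
eventually within e of a, then every finite partial sum of |a - w|^2 is at most
e^2 by passing to the limit in finitely many coordinates; hence a - w, and with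
it w, is square-summable, and w is within e of a. *)
Lemma l2_complete (F : set_system (l2 R)) : ProperFilter F -> cauchy F -> cvg F.
Proof.
move=> FF /cauchy_ballP Fc.
have center (e : R) : 0 < e -> exists a, F [set u | l2_nrm (a - u) < e].
  move=> e0; have := Fc e%:C%C; rewrite ltcR => /(_ e0) H.
  have [[A B] [FA FB] AB] := H; have [a Aa] := filter_ex FA.
  exists a; apply: filterS FB => u Bu.
  by have := AB (a, u) (conj Aa Bu); rewrite /= l2_ballE.
have cvg_coord (p : R[i] -> R) n : (forall x, p x ^+ 2 <= sqmod x) ->
    {morph p : x y / x - y} -> cvg ((fun u => p (u n)) @ F).
  move=> pS pB; apply: cauchy_cvg; apply: cauchy_exP => e e0.
  have [a Fa] := center e e0; exists (p (a n)).
  suff: F [set u : l2 R | `|p (a n) - p (u n)| < e] by [].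
  apply: filterS Fa => u /= au; rewrite -pB.
  rewrite -ltr_sqr ?nnegrE ?(ltW e0)// real_normK ?num_real//.
  apply: le_lt_trans (pS _) _; apply: le_lt_trans (l2_coord_nrm (a - u) n) _.
  by rewrite ltr_sqr ?nnegrE ?sqrtr_ge0// ltW.
have ReP n : cvg ((fun u : l2 R => complex.Re (u n)) @ F).
  apply: cvg_coord => [x|[? ?] [? ?]//]; by rewrite lerDl sqr_ge0.
have ImP n : cvg ((fun u : l2 R => complex.Im (u n)) @ F).
  apply: cvg_coord => [x|[? ?] [? ?]//]; by rewrite lerDr sqr_ge0.
pose w n : R[i] := Complex (lim ((fun u : l2 R => complex.Re (u n)) @ F))
                           (lim ((fun u : l2 R => complex.Im (u n)) @ F)).
have sum_cvg (a : l2 R) N :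
    (fun u : l2 R => \sum_(n < N) sqmod (a n - u n)) @ F -->
    \sum_(n < N) sqmod (a n - w n).
  elim: N => [|N IH].
    rewrite big_ord0 (_ : (fun u => _) = fun=> 0); first exact: cvg_cst.
    by apply/funext => u; rewrite big_ord0.
  rewrite big_ord_recr (_ : (fun u => _) = (fun u : l2 R =>
      \sum_(n < N) sqmod (a n - u n) + sqmod (a N - u N))) /=; last first.
    by apply/funext => u; rewrite big_ord_recr.
  apply: cvgD IH _.
  have sqmodB (x y : R[i]) : sqmod (x - y) =
      (complex.Re x - complex.Re y) * (complex.Re x - complex.Re y) +
      (complex.Im x - complex.Im y) * (complex.Im x - complex.Im y).
    by case: x y => ? ? [].
  rewrite sqmodB (_ : (fun u => _) = fun u : l2 R =>
      (complex.Re (a N) - complex.Re (u N)) * (complex.Re (a N) - complex.Re (u N)) +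
      (complex.Im (a N) - complex.Im (u N)) * (complex.Im (a N) - complex.Im (u N)));
    last by apply/funext => u; exact: sqmodB.
  have cRe : (fun u : l2 R => complex.Re (a N) - complex.Re (u N)) @ F -->
      complex.Re (a N) - complex.Re (w N) by apply: cvgB (ReP N); exact: cvg_cst.
  have cIm : (fun u : l2 R => complex.Im (a N) - complex.Im (u N)) @ F -->
      complex.Im (a N) - complex.Im (w N) by apply: cvgB (ImP N); exact: cvg_cst.
  exact: cvgD (cvgM cRe cRe) (cvgM cIm cIm).
have sum_le (a : l2 R) (e : R) N : F [set u | l2_nrm (a - u) < e] ->
    \sum_(n < N) sqmod (a n - w n) <= e ^+ 2.
  move=> Fa; apply: cvgr_to_le (sum_cvg a N) _; apply: filterS Fa => u /= au.
  have e0 : 0 <= e by apply: le_trans (ltW au); exact: sqrtr_ge0.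
  apply: (@le_trans _ _ (l2_nrm (a - u) ^+ 2)); last first.
    by rewrite ler_sqr ?nnegrE ?sqrtr_ge0// ltW.
  rewrite l2_nrm_sqr; have /(square_summableP (a - u)) cu := l2P (a - u).
  exact: partial_sum_le_lim (fun n => sqmod_ge0 _) cu.
have diffP (a : l2 R) (e : R) : F [set u | l2_nrm (a - u) < e] ->
    (fun n => a n - w n) \in square_summable (R := R).
  move=> Fa; apply/(square_summableP (fun n => a n - w n)).
  by have [] := nonneg_series_bounded (fun n => sqmod_ge0 (a n - w n))
                                      (fun N => sum_le a e N Fa).
have wP : w \in square_summable (R := R).
  have [a Fa] := center 1 ltr01.
  rewrite (_ : w = l2_val (a - L2 (diffP a 1 Fa))); first exact: l2P.
  apply/funext => n.
  by rewrite /= [RHS]/GRing.add /= [X in _ = _ + X]/GRing.opp /= opprB addrC subrK.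
apply/cvg_ex; exists (L2 wP); apply/cvgrPdist_lt => e.
rewrite ltcE => /andP[/eqP ie e0].
(* a positive element of R[i] is real *)
have {ie} -> : e = (complex.Re e)%:C%C by case: e ie {e0} => ? ? /= ->.
move: {e} (complex.Re e) e0 => e e0.
have e2 : 0 < e / 2 by rewrite divr_gt0.
have [a Fa] := center _ e2; apply: filterS (Fa) => u /= au.
rewrite l2_normE ltcR (_ : L2 wP - u = (L2 wP - a) + (a - u)); last first.
  by rewrite addrA subrK.
apply: le_lt_trans (l2_nrmD _ _) _; rewrite [ltRHS]splitr; apply: ler_ltD => //.
rewrite -ler_sqr ?nnegrE ?sqrtr_ge0 ?(ltW e2)// l2_nrm_sqr -opprB -scaleN1r l2_sqZ.
rewrite (_ : sqmod (-1) = 1) ?mul1r; last first.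
  by rewrite /sqmod /= oppr0 expr0n addr0 sqrrN expr1n.
by have [] := nonneg_series_bounded (fun n => sqmod_ge0 (a n - w n))
                                    (fun N => sum_le a _ N Fa).
Qed.

HB.instance Definition _ := Uniform_isComplete.Build (l2 R) l2_complete.

Lemma l2_inner_norm u : l2_dot u u = `|u| ^+ 2.
Proof. by rewrite l2_dotE l2_normE -rmorphXn /= l2_nrm_sqr. Qed.

Definition l2_hilbert : hilbertType R := HilbertType l2_inner_norm.
End L2Norm.

(** * Norm estimates in a Hilbert space with a unitary representation *)

Section HilbertGeometry.
Variables (R : realType) (V : hilbertType R).
Implicit Types u v : V.

(** The norm takes values in R[i], where order reasoning is awkward; this is the
same number as an element of R. *)
Definition hnorm v : R := complex.Re `|v|.

Lemma hnormE v : `|v| = (hnorm v)%:C%C.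
Proof. by rewrite /hnorm RRe_real ?normr_real. Qed.

Lemma hnorm_ge0 v : 0 <= hnorm v.
Proof. by rewrite -lecR -hnormE normr_ge0. Qed.

Lemma hnorm0_eq0 v : hnorm v = 0 -> v = 0.
Proof. by move=> v0; apply/eqP; rewrite -normr_eq0 hnormE v0. Qed.

Lemma hnormD u v : hnorm (u + v) <= hnorm u + hnorm v.
Proof. by rewrite -lecR rmorphD /= -!hnormE; exact: ler_normD. Qed.

Lemma hnormZ (x : R) v : 0 <= x -> hnorm (x%:C%C *: v) = x * hnorm v.
Proof.
move=> x0; apply: complexI.
by rewrite -hnormE normrZ rmorphM /= -hnormE ger0_norm ?ler0c.
Qed.

Lemma hnorm_sum (I : Type) (r : seq I) (F : I -> V) :
  hnorm (\sum_(i <- r) F i) <= \sum_(i <- r) hnorm (F i).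
Proof.
elim: r => [|i r IH]; first by rewrite !big_nil /hnorm normr0.
by rewrite !big_cons; apply: le_trans (hnormD _ _) _; rewrite lerD2l.
Qed.

Lemma parallelogram u v :
  hnorm (u + v) ^+ 2 + hnorm (u - v) ^+ 2 = 2 * (hnorm u ^+ 2 + hnorm v ^+ 2).
Proof.
apply: complexI; rewrite rmorphM rmorph_nat !rmorphD !rmorphXn /= -!hnormE.
by rewrite -!inner_norm dnormD dnormB /=; ring.
Qed.

Lemma hnorm_unitary (T : {linear V -> V}) v : unitary T -> hnorm (T v) = hnorm v.
Proof.
move=> [_ Tdot]; apply/eqP; rewrite -(@eqrXn2 _ 2) ?hnorm_ge0//.
apply/eqP/complexI.
by rewrite !rmorphXn /= -!hnormE -!inner_norm Tdot.
Qed.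

(** Uniform convexity: the parallelogram identity gives
|u + v|^2 <= (4 - k^2) |v|^2 <= (2 - k^2/4)^2 |v|^2. *)
Lemma sum_contract u v (k : R) : 0 <= k <= 1 -> hnorm u = hnorm v ->
  k * hnorm v <= hnorm (u - v) -> hnorm (u + v) <= (2 - k ^+ 2 / 4) * hnorm v.
Proof.
move=> /andP[k0 k1] uv kv.
have k2 : 0 <= k ^+ 2 <= 1 by rewrite sqr_ge0 expr_le1.
rewrite -ler_sqr ?nnegrE ?hnorm_ge0 ?mulr_ge0 ?hnorm_ge0//; last by move: k2; lra.
have : (k * hnorm v) ^+ 2 <= hnorm (u - v) ^+ 2.
  by rewrite ler_sqr ?nnegrE ?mulr_ge0 ?hnorm_ge0.
have := parallelogram u v; rewrite uv !exprMn.
have := sqr_ge0 (hnorm v).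
move: (hnorm v ^+ 2) (hnorm (u + v) ^+ 2) (hnorm (u - v) ^+ 2).
move: (k ^+ 2) => t x y z x0 E h.
(* (2 - t/4)^2 = 4 - t + t^2/16 *)
have : 0 <= t ^+ 2 * x by rewrite mulr_ge0 ?sqr_ge0.
by move=> h2; nra.
Qed.

End HilbertGeometry.

Section Representation.
Variables (R : realType) (G : groupType) (V : hilbertType R).
Variable pi : G -> {linear V -> V}.
Hypothesis pi_rep : unitary_representation pi.

Lemma rep1 v : pi 1%g v = v.
Proof.
have [piU piM] := pi_rep; have [/bij_inj inj _] := piU 1%g.
by apply: inj; rewrite -piM mulg1.
Qed.

(** The triangle inequality along the word: each letter moves v by at most d,
and the letters to its left act isometrically. *)
Lemma displacement_word (S : set G) (d : R) v w :
    (forall s, S s -> hnorm (pi s v - v) <= d) -> (forall s, s \in w -> S s) ->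
  hnorm (pi (\prod_(s <- w) s)%g v - v) <= (size w)%:R * d.
Proof.
have [piU piM] := pi_rep; move=> Sd; elim: w => [|a w IH] wS.
  by rewrite big_nil rep1 subrr mul0r /hnorm normr0.
rewrite big_cons piM -(subrK (pi a v) (pi a _)) -addrA -linearB.
apply: le_trans (hnormD _ _) _.
rewrite hnorm_unitary //= -addn1 natrD mulrDl mul1r.
by apply: lerD; [apply: IH => s sw; apply: wS; rewrite inE sw orbT|
  apply: Sd; apply: wS; rewrite inE eqxx].
Qed.

Variable T : seq G.

(** The walk is lazy: the summand v is the step that stays put. It lets
[markov_contract] compare v itself with one of its translates. *)
Definition markov v : V :=
  ((size T).+1%:R^-1)%:C%C *: (v + \sum_(s <- T) pi s v).

Lemma markov0 : markov 0 = 0.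
Proof. by rewrite /markov big1 ?addr0 ?scaler0// => s _; rewrite linear0. Qed.

(** Pairing v with a translate that is far from v gains k^2/4 in the sum of the
size T + 1 vectors; the other translates are bounded by their norms. *)
Lemma markov_contract (k : R) v : 0 <= k <= 1 ->
    (exists2 s, s \in T & k * hnorm v <= hnorm (pi s v - v)) ->
  hnorm (markov v) <= (1 - k ^+ 2 / (4 * (size T).+1%:R)) * hnorm v.
Proof.
have [piU piM] := pi_rep; move=> k01 [s sT sv].
rewrite hnormZ ?invr_ge0// mulrC ler_pdivrMr ?ltr0n// mulrAC.
have n0 : (size T).+1%:R != 0 :> R by rewrite pnatr_eq0.
rewrite [X in X * hnorm v](_ : _ = (size T)%:R + 1 - k ^+ 2 / 4); last first.
  by move: n0; rewrite -natr1; move: (size T)%:R => x x0; field.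
rewrite (big_rem s sT) /= addrA (addrC v).
have rem_le : hnorm (\sum_(t <- rem s T) pi t v) <= ((size T)%:R - 1) * hnorm v.
  apply: le_trans (hnorm_sum _ _) _.
  under eq_bigr do rewrite hnorm_unitary//.
  rewrite big_const_seq iter_addr_0 count_predT size_rem// -[leLHS]mulr_natl.
  rewrite (_ : (size T).-1%:R = (size T)%:R - 1)//.
  by case: (T) sT => // a T' _; rewrite /= -natr1 addrK.
apply: le_trans (hnormD _ _) _.
have := sum_contract k01 (hnorm_unitary v (piU s)) sv; lra.
Qed.

End Representation.

(** * Permutation operators on square-summable sequences *)

Section PermutationOperator.
Variable R : realType.
Implicit Types u v : l2 R.

Lemma comp_square_summable (s : nat -> nat) u : injective s ->
  (fun n => u (s n)) \in square_summable (R := R).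
Proof.
move=> sI; apply/(square_summableP (fun n => u (s n))).
have /(square_summableP u) cu := l2P u.
by have [] := series_comp_inj (fun n => sqmod_ge0 (u n)) cu sI.
Qed.

Definition l2_comp s (sI : injective s) u : l2 R := L2 (comp_square_summable u sI).

Lemma l2_comp_linear s (sI : injective s) : linear (l2_comp sI).
Proof. by move=> a u v; apply: val_inj. Qed.

HB.instance Definition _ s (sI : injective s) :=
  GRing.isLinear.Build R[i] (l2 R) (l2 R) *:%R (l2_comp sI) (l2_comp_linear sI).

Lemma l2_comp_sq_le s (sI : injective s) u : l2_sq (l2_comp sI u) <= l2_sq u.
Proof.
have /(square_summableP u) cu := l2P u.
by have [] := series_comp_inj (fun n => sqmod_ge0 (u n)) cu sI.
Qed.

Lemma l2_compK s t (sI : injective s) (tI : injective t) :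
  cancel t s -> cancel (l2_comp sI) (l2_comp tI).
Proof. by move=> ts u; apply/val_inj/funext => n /=; rewrite ts. Qed.

(** Polarization: real parts of inner products are determined by norms, and
imaginary parts are real parts after multiplication by i. *)
Lemma dot_preserving (T : {linear l2 R -> l2 R}) :
    (forall u, l2_sq (T u) = l2_sq u) ->
  forall u v, l2_dot (T u) (T v) = l2_dot u v.
Proof.
move=> Tsq.
have Re_eq u v : complex.Re (l2_dot (T u) (T v)) = complex.Re (l2_dot u v).
  have := l2_sqD (T u) (T v); rewrite -linearD !Tsq l2_sqD => /addrI.
  by move/(mulfI _) => ->//; rewrite pnatr_eq0.
have dot_i u v : complex.Re (l2_dot ('i%C *: u) v) = - complex.Im (l2_dot u v).
  by rewrite linearZl_LR /=; ring.
move=> u v; apply/eqP; rewrite eq_complex Re_eq eqxx /=.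
by apply/eqP/oppr_inj; rewrite -!dot_i -linearZ Re_eq.
Qed.

(** Composition with s and composition with its inverse do not increase norms,
so both preserve them. *)
Lemma l2_comp_unitary s t (sI : injective s) :
  cancel s t -> cancel t s -> unitary (V := l2_hilbert R) (l2_comp sI).
Proof.
move=> st ts; have tI := can_inj ts; split.
  by exists (l2_comp tI); exact: l2_compK.
apply: dot_preserving => u; apply/eqP; rewrite eq_le l2_comp_sq_le /=.
by rewrite -{1}(l2_compK sI tI ts u) l2_comp_sq_le.
Qed.

Lemma l2_const0 u : (forall n, u n = u 0%N) -> u = 0.
Proof.
move=> uc; have /(square_summableP u) cu := l2P u.
have u0 : u 0%N = 0.
  have := cvg_series_cvg_0 cu.
  rewrite (_ : (fun n => _) = fun=> sqmod (u 0%N)); last first.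
    by apply/funext => n; rewrite uc.
  move=> /(cvg_lim (@Rhausdorff R)); rewrite lim_cst; last exact: Rhausdorff.
  by move=> c0; apply: sqmod_eq0; rewrite c0.
by apply/val_inj/funext => n; exact: etrans (uc n) u0.
Qed.

Definition delta_fun m : nat -> R[i] := fun n => (n == m)%:R.

Lemma delta_bounded m N : \sum_(n < N) sqmod (delta_fun m n) <= 1.
Proof.
rewrite (eq_bigr (fun n : 'I_N => ((n : nat) == m)%:R)); last first.
  by move=> n _; rewrite /sqmod /delta_fun; case: eqP => _ /=; ring.
have [mN|Nm] := ltnP m N.
  rewrite (bigD1 (Ordinal mN)) //= eqxx big1 ?addr0// => n.
  by rewrite -val_eqE /= => /negPf ->.
by rewrite big1 // => n _; rewrite ltn_eqF// (leq_trans (ltn_ord n)).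
Qed.

Lemma delta_square_summable m : delta_fun m \in square_summable (R := R).
Proof.
apply/(square_summableP (delta_fun m)).
by have [] := nonneg_series_bounded (fun n => sqmod_ge0 (delta_fun m n))
                                    (delta_bounded m).
Qed.

Definition l2_delta m : l2 R := L2 (delta_square_summable m).

Lemma l2_delta_sq m : l2_sq (l2_delta m) <= 1.
Proof.
by have [] := nonneg_series_bounded (fun n => sqmod_ge0 (delta_fun m n))
                                    (delta_bounded m).
Qed.

Lemma Re_l2_le u n : complex.Re (u n) <= hnorm (u : l2_hilbert R).
Proof.
have h : complex.Re (u n) ^+ 2 <= l2_nrm u ^+ 2.
  by apply: le_trans (l2_coord_nrm u n); rewrite lerDl sqr_ge0.
apply: le_trans (ler_norm _) _.
by rewrite -ler_sqr ?nnegrE ?hnorm_ge0// real_normK ?num_real.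
Qed.

End PermutationOperator.

(** * The quasi-regular representation on a coset space *)

(** The right cosets of a subgroup are represented by their labels in nat: two
elements are in the same coset when phi takes the same value at them, and phiM
says that right translations permute the labels. *)
Section CosetRepresentation.
Variables (R : realType) (G : groupType) (phi : G -> nat).
Hypothesis phi_surj : forall n, exists x, phi x = n.
Hypothesis phiM :
  forall x y g : G, phi x = phi y -> phi (x * g)%g = phi (y * g)%g.

Definition lift n : G := sval (cid (phi_surj n)).

Lemma liftK n : phi (lift n) = n. Proof. exact: svalP (cid (phi_surj n)). Qed.

Definition translate g n : nat := phi (lift n * g)%g.

Lemma translate_phi g x : translate g (phi x) = phi (x * g)%g.
Proof. by apply: phiM; rewrite liftK. Qed.

Lemma translateM g h n : translate (g * h)%g n = translate h (translate g n).
Proof. by rewrite -[n]liftK !translate_phi mulgA. Qed.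

Lemma translate1 n : translate 1%g n = n.
Proof. by rewrite -[n]liftK translate_phi mulg1. Qed.

Lemma translateK g : cancel (translate g) (translate g^-1%g).
Proof. by move=> n; rewrite -translateM mulgV translate1. Qed.

Lemma translateVK g : cancel (translate g^-1%g) (translate g).
Proof. by move=> n; rewrite -translateM mulVg translate1. Qed.

Lemma translate_inj g : injective (translate g).
Proof. exact: can_inj (translateK g). Qed.

Definition quasi_regular g : {linear l2_hilbert R -> l2_hilbert R} :=
  l2_comp (R := R) (@translate_inj g).

Lemma quasi_regular_rep : unitary_representation quasi_regular.
Proof.
split=> [g|g h v]; first exact: l2_comp_unitary (translateK g) (translateVK g).
by apply/val_inj/funext => n /=; rewrite translateM.
Qed.

(** G permutes the labels transitively, so an invariant vector is constant. *)
Lemma quasi_regular_no_invariant (v : l2_hilbert R) :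
  (forall g, quasi_regular g v = v) -> v = 0.
Proof.
move=> inv; apply: l2_const0 => n.
have : quasi_regular ((lift 0)^-1 * lift n)%g v 0%N = v 0%N by rewrite inv.
have -> : quasi_regular ((lift 0)^-1 * lift n)%g v 0%N =
    v (translate ((lift 0)^-1 * lift n)%g 0%N) by [].
by rewrite -[X in translate _ X]liftK translate_phi mulgA mulgV mul1g liftK.
Qed.

End CosetRepresentation.

(** * Right cosets of a subgroup of infinite index *)

Section Cosets.
Variables (G : groupType) (H : set G).

Lemma right_cosetM x g :
  right_coset H (x * g)%g = [set (y * g)%g | y in right_coset H x].
Proof.
apply/seteqP; split=> [_ [h Hh <-]|_ [_ [h Hh <-] <-]].
  by exists (h * x)%g; [exists h|rewrite mulgA].
by exists h => //; rewrite mulgA.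
Qed.

Lemma mem_right_coset x g : subgroup H ->
  right_coset H g x <-> right_coset H x = right_coset H g.
Proof.
move=> [H1 HV].
have Hinv h : H h -> H h^-1%g by move=> Hh; have := HV _ _ H1 Hh; rewrite mul1g.
have HM a b : H a -> H b -> H (a * b)%g.
  by move=> Ha Hb; have := HV _ _ Ha (Hinv _ Hb); rewrite invgK.
split=> [[h Hh <-]|<-]; last by exists 1%g; rewrite ?mul1g.
apply/seteqP; split=> _ [k Hk <-].
  by exists (k * h)%g; [exact: HM|rewrite mulgA].
by exists (k * h^-1)%g; [exact: HV|rewrite mulgA mulgVK].
Qed.

Lemma coset_enumeration : countable [set: G] -> infinite_index H ->
  exists phi : G -> nat, (forall n, exists x, phi x = n) /\
    forall x y, phi x = phi y <-> right_coset H x = right_coset H y.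
Proof.
move=> cG iH; have cH : countable (range (right_coset H)).
  exact: card_le_trans (card_image_le _ _) cG.
have /card_set_bijP[f [_ finj fsurj]] := eq_card_nat cH iH.
exists (fun x => f (right_coset H x)); split.
  by move=> n; have [_ [x _ <-] <-] := fsurj n I; exists x.
move=> x y; split=> [|-> //] fxy.
by apply: finj fxy; rewrite inE; [exists x|exists y].
Qed.

End Cosets.

Lemma generated_countable (G : groupType) (S : set G) :
  finite_set S -> symmetric_set S -> generates S -> countable [set: G].
Proof.
move=> finS symS genS.
have -> : [set: G] = \bigcup_n word_ball S n.
  apply/seteqP; split=> // g _; exists (word_length S g) => //=.
  by rewrite /word_ball /=.
by apply: bigcup_countable => // n _; exact/finite_set_countable/finite_word_ball.
Qed.

(** * The uniform displacement given by property (T) *)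

(** If Q is the Kazhdan set, eps its constant and L bounds the word lengths of
the elements of Q, then a vector that is moved by less than eps / (L + 1) times
its norm by every letter is moved by less than eps times its norm by every
element of Q. The bound k <= 1 is imposed for [sum_contract]. *)
Lemma kazhdan_gap (R : realType) (G : groupType) (S : set G) :
    symmetric_set S -> generates S -> property_T R G ->
  exists2 k : R, 0 < k <= 1 &
    forall (V : hilbertType R) (pi : G -> {linear V -> V}),
    unitary_representation pi -> (forall v, (forall g, pi g v = v) -> v = 0) ->
    forall v, v != 0 -> exists2 s, S s & k * hnorm v <= hnorm (pi s v - v).
Proof.
move=> symS genS [Q [eps [/finite_seqP[q ->] eps0 kazhdan]]].
pose L := \max_(x <- q) word_length S x.
exists (Num.min 1 (eps / L.+1%:R)).
  by rewrite lt_min ltr01 divr_gt0 ?ltr0n//= ge_min lexx.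
move=> V pi pi_rep noinv v v0; apply: contrapT => noS.
have hv : 0 < hnorm v.
  by rewrite lt_def hnorm_ge0 andbT; apply: contra_neq v0; exact: hnorm0_eq0.
set k := Num.min _ _ in noS *.
have Sv s : S s -> hnorm (pi s v - v) <= k * hnorm v.
  by move=> Ss; rewrite leNgt; apply/negP => /ltW h; apply: noS; exists s.
have [|w [w0 winv]] := kazhdan V pi pi_rep; last first.
  by move: w0; rewrite (noinv w winv) eqxx.
exists v; split=> // x xq.
rewrite !hnormE -rmorphM ltcR; have [w wx wS] := word_lengthP x symS genS.
case: wS => wS <-; apply: le_lt_trans (displacement_word pi_rep Sv wS) _.
rewrite mulrA ltr_pM2r//.
have wL : ((size w)%:R : R) <= L%:R by rewrite ler_nat wx; exact: leq_bigmax_seq.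
have k0 : 0 <= k by rewrite le_min ler01 divr_ge0 ?(ltW eps0).
apply: (@le_lt_trans _ _ (L%:R * (eps / L.+1%:R))).
  by apply: ler_pM => //; rewrite ge_min lexx orbT.
by rewrite mulrCA gtr_pMr// ltr_pdivrMr ?ltr0n// mul1r ltr_nat.
Qed.

(** * The random walk on the group and its visits to cosets *)

Section Walk.
Variables (R : realType) (G : groupType) (T : seq G).
Implicit Types f : G -> R.

(** With f the indicator function of a set A, the n-th iterate at x is the
probability that the lazy walk from x is in A after n steps. *)
Definition walk_avg f (x : G) : R :=
  (size T).+1%:R^-1 * (f x + \sum_(s <- T) f (x * s)%g).

Lemma walk_avg_ge1 f n x :
    (forall w, {subset w <= T} -> (size w <= n)%N ->
      1 <= f (x * \prod_(s <- w) s)%g) ->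
  1 <= iter n walk_avg f x.
Proof.
elim: n x => [|n IH] x f1 /=.
  have := f1 [::] (fun _ h => match notF h with end) isT.
  by rewrite big_nil mulg1.
rewrite {1}/walk_avg mulrC ler_pdivlMr ?ltr0n// mul1r -natr1 addrC; apply: lerD.
  by apply: IH => w wT wn; apply: f1 => //; exact: leqW.
rewrite -sum1_size natr_sum big_seq [leRHS]big_seq; apply: ler_sum => s sT.
apply: IH => w wT wn; have := f1 (s :: w); rewrite big_cons mulgA; apply=> // t.
by rewrite inE => /orP[/eqP->|/wT].
Qed.

Lemma walk_avg_sum (I : finType) (F : I -> G -> R) n x :
  iter n walk_avg (fun y => \sum_i F i y) x = \sum_i iter n walk_avg (F i) x.
Proof.
elim: n x => [//|n IH] x /=; rewrite /walk_avg IH -mulr_sumr big_split /=.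
by congr (_ * (_ + _)); rewrite exchange_big; apply: eq_bigr => s _; rewrite IH.
Qed.

End Walk.

Section CosetWalk.
Variables (R : realType) (G : groupType) (T : seq G) (k : R).
Hypothesis k01 : 0 < k <= 1.
Hypothesis gap : forall (V : hilbertType R) (pi : G -> {linear V -> V}),
  unitary_representation pi -> (forall v, (forall g, pi g v = v) -> v = 0) ->
  forall v, v != 0 -> exists2 s, s \in T & k * hnorm v <= hnorm (pi s v - v).

Definition walk_rate : R := 1 - k ^+ 2 / (4 * (size T).+1%:R).

Lemma walk_rate_bounds : 0 < walk_rate < 1.
Proof.
move: k01 => /andP[k0 k1]; rewrite /walk_rate gtrBl subr_gt0.
have N0 : (1 : R) <= (size T).+1%:R by rewrite ler1n.
rewrite divr_gt0 ?exprn_gt0 ?mulr_gt0 ?ltr0n// andbT ltr_pdivrMr; last by lra.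
have : k ^+ 2 <= 1 by rewrite expr_le1// ltW.
lra.
Qed.

(** The function on G that is constant on right cosets and given on them by a
vector w of l2 is averaged by [walk_avg] as w is by [markov]. Starting from the
unit vector at Hg, each step contracts the norm by the walk rate, and the norm
bounds every coordinate. *)
Lemma walk_avg_coset (H : set G) g n x : countable [set: G] ->
    subgroup H -> infinite_index H ->
  iter n (walk_avg T) \1_(right_coset H g) x <= walk_rate ^+ n.
Proof.
move=> cG sH iH; have [phi [surj phiE]] := coset_enumeration cG iH.
have phiM x1 y1 z : phi x1 = phi y1 -> phi (x1 * z)%g = phi (y1 * z)%g.
  by move=> /phiE e; apply/phiE; rewrite !right_cosetM e.
pose pi := quasi_regular R surj phiM.
have pi_rep := quasi_regular_rep R surj phiM.
have pi_noinv :=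
  quasi_regular_no_invariant (R := R) (phi_surj := surj) (phiM := phiM).
pose u m : l2_hilbert R := iter m (markov pi T) (l2_delta R (phi g)).
have [rate0 rate1] := andP walk_rate_bounds.
have u_le m : hnorm (u m) <= walk_rate ^+ m.
  elim: m => [|m IH].
    rewrite expr0 -(@expr_le1 _ 2) ?hnorm_ge0//.
    by apply: le_trans (l2_delta_sq R (phi g)); rewrite -l2_nrm_sqr.
  apply: (@le_trans _ _ (walk_rate * hnorm (u m))); last first.
    by rewrite exprS ler_wpM2l // ltW.
  have -> : u m.+1 = markov pi T (u m) by [].
  have [um0|u0] := eqVneq (u m) (0 : l2_hilbert R).
    by rewrite um0 markov0 /hnorm normr0 mulr0.
  have k01' : 0 <= k <= 1 by move: k01 => /andP[/ltW -> ->].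
  exact: (markov_contract pi_rep k01' (gap pi_rep pi_noinv u0)).
pose e m (w : l2_hilbert R) := complex.Re (w m).
have eD m : {morph e m : a b / a + b}.
  move=> a b; rewrite -[LHS]/(complex.Re (a m + b m)) /e.
  by case: (a m) (b m) => ? ? [].
have e0 m : e m 0 = 0 by [].
have eZ m (a : R) w : e m (a%:C%C *: w) = a * e m w.
  rewrite -[LHS]/(complex.Re (a%:C%C * w m)) /e.
  by case: (w m) => b c /=; rewrite mul0r subr0.
have uE m y : iter m (walk_avg T) \1_(right_coset H g) y = e (phi y) (u m).
  elim: m y => [|m IH] y /=.
    rewrite /e /= /delta_fun indicE.
    have -> : (y \in right_coset H g) = (phi y == phi g).
      apply/idP/eqP; first by rewrite inE => /(mem_right_coset _ _ sH)/phiE.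
      by move=> /phiE/(mem_right_coset _ _ sH); rewrite inE.
    by case: eqP.
  rewrite {1}/walk_avg /markov eZ eD (big_morph (e (phi y)) (eD _) (e0 _)).
  rewrite IH; congr (_ * (_ + _)); apply: eq_bigr => s _; rewrite IH.
  by rewrite -(translate_phi surj phiM).
by rewrite uE; apply: le_trans (u_le n); exact: Re_l2_le.
Qed.

End CosetWalk.

(** * The coset covering function *)

Theorem theorem3 (R : realType) (G : groupType) (S : set G)
    (Ginf : infinite_set [set: G]) (Sfin : finite_set S)
    (Ssym : symmetric_set S) (Sgen : generates S) (GT : property_T R G) :
  exists2 eps : R, 0 < eps &
    forall r : nat, expR (eps * r%:R) <= (coset_covering S r)%:R.
Proof.
have cG := generated_countable Sfin Ssym Sgen.
have [k k01 gap] := kazhdan_gap Ssym Sgen GT.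
have /finite_seqP[T ST] := Sfin.
have [c0 c1] := andP (walk_rate_bounds T k01).
exists (- ln (walk_rate T k)); first by rewrite oppr_gt0 ln_lt0 ?c0.
move=> r; have [[C [Ccii Ccov]] _] := coset_coveringP r Ginf Sfin Ssym Sgen.
set N := coset_covering S r in C Ccii Ccov *.
rewrite expRM_natr expRN lnK ?posrE// exprVn -[leLHS]mul1r.
rewrite ler_pdivrMr ?exprn_gt0//.
(* after r steps from 1 the walk is in the ball, hence in some C i *)
have cover1 :
    1 <= iter r (walk_avg T) (fun y => \sum_i \1_(C i) y) (1%g : G) :> R.
  apply: walk_avg_ge1 => w wT wr; rewrite mul1g.
  have [|i _ Ci] := Ccov (\prod_(s <- w) s)%g.
    rewrite /word_ball /=; apply: leq_trans wr.
    have wW : exists2 v, size v = size w & word_in S v (\prod_(s <- w) s)%g.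
      by exists w => //; split=> // s /wT; rewrite ST.
    exact: (nat_minP (ex_intro _ (size w) wW)).2 _ wW.
  rewrite (bigD1 i)//= indicE mem_set//= lerDl; apply: sumr_ge0 => j _.
  by rewrite indicE.
apply: le_trans cover1 _; rewrite walk_avg_sum.
apply: (@le_trans _ _ (\sum_(i < N) walk_rate T k ^+ r)).
  apply: ler_sum => i _; have [H [g [sH iH ->]]] := Ccii i.
  apply: walk_avg_coset => //.
  move=> V pi pi_rep noinv v v0; have [s Ss hs] := gap V pi pi_rep noinv v v0.
  by exists s => //; move: Ss; rewrite ST.
by rewrite sumr_const card_ord mulr_natl.
Qed.
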